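(* Let $X$ be a proper hereditary subclass of the class of unit interval graphs. Then the clique-width of graphs in $X$ is bounded by a constant; that is, there is a constant $c$ (depending only on $X$) such that every graph in $X$ has clique-width at most $c$.
   Context: All graphs are finite, simple and undirected. A graph is a unit interval graph if it is the intersection graph of a family of (closed) intervals of the real line all having the same length. A class of graphs (closed under isomorphism) is hereditary if with any graph it contains all induced subgraphs of that graph. A subclass of the class of unit interval graphs is proper if at least one unit interval graph does not belong to it. The clique-width of a graph $G$ is the minimum number of labels needed to construct $G$ by means of the following four operations on labeled graphs: (i) creation of a new vertex $v$ with label $i$; (ii) disjoint union of two labeled graphs; (iii) joining by an edge each vertex with label $i$ to each vertex with label $j$, where $i\ne j$; (iv) renaming label $i$ to $j$. *)

(* Defs.v *)
From mathcomp Require Import all_boot all_order all_algebra.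
From mathcomp Require Import boolp classical_sets set_interval reals.

Set Implicit Arguments.
Unset Strict Implicit.
Unset Printing Implicit Defensive.

Import Order.TTheory GRing.Theory Num.Theory.

Local Open Scope ring_scope.
Local Open Scope classical_set_scope.

(* The null graph is a graph here. *)
Record sgraph := SGraph {
  svertex :> finType;
  sedge : rel svertex;
  sedge_sym : symmetric sedge;
  sedge_irr : irreflexive sedge }.

Definition isomorphic (G H : sgraph) : Prop :=
  exists2 f : G -> H, bijective f & forall x y, sedge (f x) (f y) = sedge x y.

Section Induced.
Variables (G : sgraph) (S : {set G}).

Definition induced_edge : rel {x : G | x \in S} :=
  fun x y => sedge (val x) (val y).

Lemma induced_edge_sym : symmetric induced_edge.
Proof. by move=> x y; exact: sedge_sym. Qed.

Lemma induced_edge_irr : irreflexive induced_edge.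
Proof. by move=> x; exact: sedge_irr. Qed.

Definition induced : sgraph := SGraph induced_edge_sym induced_edge_irr.
End Induced.

Definition hereditary (X : sgraph -> Prop) : Prop :=
  (forall G H : sgraph, isomorphic G H -> X G -> X H) /\
  (forall (G : sgraph) (S : {set G}), X G -> X (induced S)).

(* [l] is the common length and [a v] the left endpoint of the interval of [v];
   distinct vertices may receive the same interval. *)
Definition unit_interval_graph (R : realType) (G : sgraph) : Prop :=
  exists (l : R) (a : G -> R), 0 < l /\
    forall u v : G, u != v ->
      (sedge u v <-> `[a u, a u + l] `&` `[a v, a v + l] !=set0).

Record lgraph (k : nat) := LGraph {
  lgraph_graph :> sgraph;
  label : lgraph_graph -> 'I_k }.

Section Operations.
Variable k : nat.

Definition vertex_edge : rel unit := fun _ _ => false.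

Lemma vertex_edge_sym : symmetric vertex_edge. Proof. by []. Qed.
Lemma vertex_edge_irr : irreflexive vertex_edge. Proof. by []. Qed.

Definition lvertex (i : 'I_k) : lgraph k :=
  @LGraph k (SGraph vertex_edge_sym vertex_edge_irr) (fun _ => i).

Section Union.
Variables G H : lgraph k.

Definition union_edge : rel (G + H)%type := fun x y =>
  match x, y with
  | inl x, inl y => sedge x y
  | inr x, inr y => sedge x y
  | _, _ => false
  end.

Lemma union_edge_sym : symmetric union_edge.
Proof. by move=> [x|x] [y|y] //=; exact: sedge_sym. Qed.

Lemma union_edge_irr : irreflexive union_edge.
Proof. by move=> [x|x] /=; exact: sedge_irr. Qed.

Definition lunion : lgraph k :=
  @LGraph k (SGraph union_edge_sym union_edge_irr)
    (fun x => match x with inl x => label x | inr x => label x end).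
End Union.

Section Join.
Variables (i j : 'I_k) (ij : i != j) (G : lgraph k).

Definition join_edge : rel G := fun x y =>
  [|| sedge x y, (label x == i) && (label y == j)
    | (label x == j) && (label y == i)].

Lemma join_edge_sym : symmetric join_edge.
Proof.
move=> x y; rewrite /join_edge sedge_sym.
by do !case: (label _ == _); rewrite ?orbT.
Qed.

Lemma join_edge_irr : irreflexive join_edge.
Proof.
move=> x; rewrite /join_edge sedge_irr /= andbC orbb.
by apply/negP => /andP[/eqP-> ji]; move: (ij); rewrite (eqP ji) eqxx.
Qed.

Definition ljoin : lgraph k :=
  @LGraph k (SGraph join_edge_sym join_edge_irr) (@label k G).
End Join.

Definition lrename (i j : 'I_k) (G : lgraph k) : lgraph k :=
  @LGraph k G (fun x => if label x == i then j else label x).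

Inductive cwexp : Type :=
  | CWVertex of 'I_k
  | CWUnion of cwexp & cwexp
  | CWJoin (i j : 'I_k) of i != j & cwexp
  | CWRename of 'I_k & 'I_k & cwexp.

Fixpoint cweval (t : cwexp) : lgraph k :=
  match t with
  | CWVertex i => lvertex i
  | CWUnion t1 t2 => lunion (cweval t1) (cweval t2)
  | CWJoin i j ij t => ljoin ij (cweval t)
  | CWRename i j t => lrename i j (cweval t)
  end.
End Operations.

(* The operations only build nonempty graphs; by convention the null graph
   needs no label. *)
Definition cw_constructible (k : nat) (G : sgraph) : Prop :=
  #|G| = 0%N \/ exists t : cwexp k, isomorphic (cweval t) G.

Lemma cwexp_discrete (G : sgraph) (s : seq G) (v : G) : uniq (v :: s) ->
  exists (t : cwexp #|G|) (f : cweval t -> G),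
    [/\ injective f, forall w, w \in v :: s <-> exists x, f x = w,
        forall x, label x = enum_rank (f x) & forall x y : cweval t, ~~ sedge x y].
Proof.
elim: s v => [|w s IH] v.
  move=> _; exists (CWVertex (enum_rank v)), (fun=> v); split=> //.
  - by move=> [] [].
  - move=> w; rewrite inE; split=> [/eqP->|[_ ->//]].
    by exists tt.
rewrite cons_uniq => /andP[vs /IH[t [f [finj fs fl fe]]]].
exists (CWUnion (CWVertex (enum_rank v)) t).
exists (fun x => match x with inl _ => v | inr x => f x end); split.
- have fv x : f x <> v by move=> fx; case/negP: vs; apply/fs; exists x.
  move=> [[]|x] [[]|y] //=; first by move/esym/fv.
    by move/fv.
  by move/finj->.
- move=> u; rewrite inE; split.
    by case/orP=> [/eqP->|/fs[x <-]]; [exists (inl tt)|exists (inr x)].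
  case=> [[_ <-|x <-]]; first by rewrite eqxx.
  by apply/orP; right; apply/fs; exists x.
- by move=> [[]|x] /=.
- by move=> [[]|x] [[]|y] //=.
Qed.

Lemma cwexp_edges (G : sgraph) (v : G) (s : seq (G * G)) :
  all (fun p => p.1 != p.2) s ->
  exists (t : cwexp #|G|) (f : cweval t -> G),
    [/\ injective f, forall w, exists x, f x = w,
        forall x, label x = enum_rank (f x) &
        forall x y : cweval t,
          sedge x y = ((f x, f y) \in s) || ((f y, f x) \in s)].
Proof.
elim: s => [_|[a b] s IH /= /andP[ab /IH[t [f [finj fs fl fe]]]]].
  have [|t [f [finj fs fl fe]]] := @cwexp_discrete G (rem v (enum G)) v.
    by rewrite cons_uniq rem_uniq ?enum_uniq // mem_rem_uniq ?enum_uniq // !inE eqxx.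
  exists t, f; split=> // [w|x y]; last by rewrite (negbTE (fe x y)).
  apply/fs; rewrite inE mem_rem_uniq ?enum_uniq // !inE mem_enum.
  by case: eqP.
have rab : enum_rank a != enum_rank b by rewrite (inj_eq enum_rank_inj).
exists (CWJoin rab t), f; split=> // x y /=.
rewrite /join_edge fe !fl !(inj_eq enum_rank_inj) !inE !xpair_eqE.
rewrite [(f x == b) && _]andbC.
by do !case: (_ \in _); do !case: (_ == _).
Qed.

Lemma cw_constructible_ex (G : sgraph) :
  exists k : nat, `[< cw_constructible k G >].
Proof.
exists #|G|; apply/asboolP.
have [|] := posnP #|G|; first by left.
case/card_gt0P => v _; right.
have [|t [f [finj fs fl fe]]] :=
  @cwexp_edges G v (enum [pred p : G * G | sedge p.1 p.2]).
  apply/allP => -[x y]; rewrite mem_enum inE /= => xy.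
  by apply/eqP => e; rewrite e sedge_irr in xy.
exists t, f => [|x y]; last first.
  by rewrite fe !mem_enum !inE /= [sedge (f y) _]sedge_sym orbb.
have fs' w : exists x, f x == w by have [x <-] := fs w; exists x.
have K : cancel (fun w => xchoose (fs' w)) f.
  by move=> w; apply/eqP; exact: (xchooseP (fs' w)).
by exists (fun w => xchoose (fs' w)) => // x; apply: finj; rewrite K.
Qed.

Definition clique_width (G : sgraph) : nat := ex_minn (cw_constructible_ex G).

(* Main.v *)
Require Import Defs.
From mathcomp Require Import all_boot all_order all_algebra.
From mathcomp Require Import boolp classical_sets set_interval reals.
From mathcomp Require Import zify lra.

Set Implicit Arguments.
Unset Strict Implicit.
Unset Printing Implicit Defensive.

(** A unit interval graph is coded by two natural numbers per vertex.  After
rescaling, the position of a vertex on the line is its integer part (its column)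
plus a fractional part, and the order of the fractional parts, reversed, is
recorded by an injective height.  Two vertices of the same column are adjacent,
two vertices of consecutive columns are adjacent exactly when the one in the
later column is higher, and there are no other edges
([unit_interval_column_rep]).

Let [H] be a unit interval graph outside the class, coded with fewer than [W]
columns and fewer than [N] heights.  In the columns [b, b + W) of a graph [G] of
the class, choose greedily vertices [z_0, z_1, ...] of increasing heights, [z_n]
being the lowest admissible vertex of column [b + n mod W].  If the process
produced [N * W] vertices, then each block of [W] consecutive ones would be a row
of a grid, and sending the vertex of [H] of column [c] and height [h] to
[z_(h W + c)] would embed [H] in [G] ([grid_embedding]).  So it stops earlier.

The heights of the chosen vertices cut the graph into at most [N * W + 1] phases.
Since the choice is greedy and the process has stopped, a vertex of phase [q]
lying in column [b + q mod W] is the lowest of its phase.  Hence the left part,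
made of the vertices [v] with [col v < b + phase v mod W], is separated from the
rest by a cut across which the neighbourhood of a vertex depends only on its
column and its phase ([cut_type]).

Such cuts are made at [b = 0, W, 2W, ...].  They are nested, and the blocks
between consecutive cuts span at most [2W] columns.  List the vertices block by
block, by increasing height in each block.  A vertex of an initial segment sees
the rest of its own block according to its column only ([block_type]), so every
cut of this linear order has a number of types bounded in terms of [W] and [N].
Adding the vertices in this order, with one label for each type and one more for
the new vertex, builds the graph ([layout_cw]). *)

(** * Graphs assembled by clique-width expressions *)

(** Some expression over [K] labels builds the graph with vertex set [S], labels
[lab] and edges [E], up to a bijection onto [S].  The graph is carried by a fixed
type [V], so that only the values of [lab] and [E] on [S] matter. *)
Definition built (K : nat) (V : Type) (S : V -> Prop) (lab : V -> 'I_K)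
    (E : V -> V -> bool) : Prop :=
  exists (e : cwexp K) (f : cweval e -> V),
    [/\ injective f, forall w, S w <-> exists x, f x = w,
        forall x, label x = lab (f x) &
        forall x y : cweval e, sedge x y = E (f x) (f y)].

Section Built.
Variables (K : nat) (V : Type).
Implicit Types (S : V -> Prop) (lab : V -> 'I_K) (E : V -> V -> bool).

Lemma built_ext S S' lab lab' E E' :
  (forall w, S w <-> S' w) -> (forall w, S w -> lab w = lab' w) ->
  (forall x y, S x -> S y -> E x y = E' x y) ->
  built S lab E -> built S' lab' E'.
Proof.
move=> hS hl hE [e [f [finj fS fl fE]]]; exists e, f.
have Sf x : S (f x) by apply/fS; exists x.
by split=> // [w|x|x y]; rewrite -?hS ?fl ?fE; auto.
Qed.

Lemma built_vertex v lab E : E v v = false -> built (fun w => w = v) lab E.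
Proof.
move=> Ev; exists (CWVertex (lab v)), (fun=> v); split=> //.
- by move=> [] [].
- by move=> w; split=> [->|[_ ->//]]; exists tt.
Qed.

Lemma built_union S1 S2 lab E :
  (forall x y, S1 x -> S2 y -> x <> y /\ E x y = false /\ E y x = false) ->
  built S1 lab E -> built S2 lab E -> built (fun w => S1 w \/ S2 w) lab E.
Proof.
move=> dis [e1 [f1 [inj1 fS1 fl1 fE1]]] [e2 [f2 [inj2 fS2 fl2 fE2]]].
have dis' x y : f1 x <> f2 y /\ E (f1 x) (f2 y) = false /\ E (f2 y) (f1 x) = false.
  by apply: dis; [apply/fS1; exists x|apply/fS2; exists y].
exists (CWUnion e1 e2).
exists (fun x => match x with inl x => f1 x | inr x => f2 x end); split.
- move=> [x|x] [y|y] => [/inj1->//|h|/esym h|/inj2->//].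
    by case: (dis' x y).
  by case: (dis' y x).
- move=> w; rewrite fS1 fS2; split.
    by case=> -[x <-]; [exists (inl x)|exists (inr x)].
  by case=> -[x|x] <-; [left|right]; exists x.
- by move=> [x|x] /=.
- move=> [x|x] [y|y] //=.
    by case: (dis' x y) => _ [->].
  by case: (dis' y x) => _ [_ ->].
Qed.

Lemma built_join i j S lab E : i != j -> built S lab E ->
  built S lab (fun x y => [|| E x y, (lab x == i) && (lab y == j)
                            | (lab x == j) && (lab y == i)]).
Proof.
move=> ij [e [f [finj fS fl fE]]]; exists (CWJoin ij e), f; split=> // x y.
by rewrite /= /join_edge fE !fl.
Qed.

Lemma built_rename i j S lab E : built S lab E ->
  built S (fun x => if lab x == i then j else lab x) E.
Proof.
move=> [e [f [finj fS fl fE]]]; exists (CWRename i j e), f; split=> // x.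
by rewrite /= fl.
Qed.

Lemma built_joins j (L : seq 'I_K) S lab E : j \notin L -> built S lab E ->
  built S lab (fun x y => [|| E x y, (lab x \in L) && (lab y == j)
                            | (lab x == j) && (lab y \in L)]).
Proof.
elim: L => [|i L IH] /=.
  by move=> _; apply: built_ext => // x y _ _; rewrite !in_nil andbF !orbF.
rewrite inE negb_or => /andP[ji jL] /(IH jL) /(@built_join i j).
rewrite eq_sym => /(_ ji); apply: built_ext => // x y _ _; rewrite !inE.
by do !case: (_ \in _); do !case: (_ == _); rewrite ?orbT ?orbF.
Qed.
End Built.

Lemma built_cw (K : nat) (G : sgraph) (lab : G -> 'I_K) :
  built (fun=> True) lab (@sedge G) -> cw_constructible K G.
Proof.
move=> [e [f [finj fS _ fE]]]; right; exists e, f => [|x y]; last by rewrite fE.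
have fs' w : exists x, f x == w by have [[|x <-]] := fS w; first by []; exists x.
have K1 : cancel (fun w => xchoose (fs' w)) f.
  by move=> w; apply/eqP; exact: (xchooseP (fs' w)).
by exists (fun w => xchoose (fs' w)) => // x; apply: finj; rewrite K1.
Qed.

(** * Linear layouts with few types across every cut *)

(** The vertices are listed by increasing [key].  At each [n], the vertices
listed before [n] fall into at most [#|T|] types, two vertices of the same type
having the same neighbours among the vertices that come later. *)
Section Layout.
Variables (G : sgraph) (T : finType) (key : G -> nat).
Hypothesis key_inj : injective key.
Hypothesis few_types : forall n, exists tau : G -> T, forall u u' w,
  key u < n -> key u' < n -> n <= key w -> tau u = tau u' ->
  sedge u w = sedge u' w.

Let K := #|T|.+1.

(** The subgraph of the vertices listed before [n] can be built with one label
[j] unused, vertices with the same label having the same later neighbours. *)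
Definition layout_inv (n : nat) : Prop :=
  exists (lab : G -> 'I_K) (j : 'I_K),
    [/\ built (fun w => key w < n) lab (@sedge G),
        forall x, key x < n -> lab x != j &
        forall x y w, key x < n -> key y < n -> n <= key w ->
          lab x = lab y -> sedge x w = sedge y w].

(** The free label [j] is given to the new vertex [v], which is then joined to
the labels of its neighbours.  The first alternative covers the case where [v]
is the first vertex, as there is no expression for the null graph. *)
Lemma layout_add_vertex n v lab (j : 'I_K) : key v = n ->
  ((forall w, n <= key w) \/ built (fun w => key w < n) lab (@sedge G)) ->
  (forall x, key x < n -> lab x != j) ->
  (forall x y w, key x < n -> key y < n -> n <= key w ->
     lab x = lab y -> sedge x w = sedge y w) ->
  built (fun w => key w < n.+1) (fun w => if w == v then j else lab w)
    (@sedge G).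
Proof.
move=> kv hb hj hl.
pose lab1 w := if w == v then j else lab w.
pose E1 x y := [&& x != v, y != v & sedge x y].
have ltv x : key x < n -> (x == v) = false.
  by move=> xn; apply/negbTE; apply: contraTneq xn => ->; rewrite kv ltnn.
have ltS w : key w < n.+1 <-> key w < n \/ w = v.
  rewrite ltnS leq_eqVlt -kv; split.
    by case/orP => [/eqP/key_inj->|->]; [right|left].
  by case=> [->|->]; rewrite ?eqxx ?orbT.
have b1 : built (fun w => key w < n.+1) lab1 E1.
  case: hb => [hn|hb].
    apply: built_ext (@built_vertex _ _ v lab1 E1 _) => //.
      by move=> w; rewrite ltS ltnNge hn; split=> [->|[//|->]]; [right|].
    by rewrite /E1 eqxx.
  apply: built_ext (built_union (S1 := fun w => key w < n)
    (S2 := fun w => w = v) (lab := lab1) (E := E1) _ _ _) => //.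
  - by move=> w; rewrite ltS.
  - move=> x y xn ->; rewrite /E1 eqxx /= andbF; split=> // xv.
    by move: (ltv _ xn); rewrite xv eqxx.
  - apply: built_ext hb => // [w wn|x y xn yn]; first by rewrite /lab1 ltv.
    by rewrite /E1 !ltv.
  - by apply: built_vertex; rewrite /E1 eqxx.
pose L := [seq i <- enum 'I_K |
  (i != j) && [exists x : G, [&& key x < n, lab x == i & sedge x v]]].
have jL : j \notin L by rewrite mem_filter eqxx.
apply: built_ext (built_joins jL b1) => // x y /ltS hx /ltS hy.
have lab1v : lab1 v = j by rewrite /lab1 eqxx.
have labL z : key z < n -> (lab1 z \in L) = sedge z v.
  move=> zn; rewrite mem_filter mem_enum andbT /lab1 ltv // hj //=.
  apply/existsP/idP => [[x' /and3P[xn /eqP xz]]|zv].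
    by rewrite (hl x' z) // kv.
  by exists z; rewrite zn eqxx.
have lab1j z : key z < n -> (lab1 z == j) = false.
  by move=> zn; rewrite /lab1 ltv //; apply/negbTE/hj.
case: hx => [xn|->]; case: hy => [yn|->].
- by rewrite /E1 !ltv // !lab1j // andbF /= orbF.
- by rewrite /E1 eqxx lab1v labL // eqxx lab1j // andbF andbT orbF.
- by rewrite /E1 eqxx lab1v labL // eqxx lab1j // andbF /= sedge_sym.
- by rewrite /E1 eqxx lab1v (negbTE jL) andbF sedge_irr.
Qed.

(** If all the labels are used, two of them carry the same type and can be
merged, which frees one. *)
Lemma layout_merge n (lab : G -> 'I_K) :
  built (fun w => key w < n) lab (@sedge G) ->
  (forall x y w, key x < n -> key y < n -> n <= key w ->
     lab x = lab y -> sedge x w = sedge y w) ->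
  layout_inv n.
Proof.
move=> hb hl.
have [[j hj]|nj] := pselect (exists j, forall x, key x < n -> lab x != j).
  by exists lab, j.
have used i : exists x, (key x < n) && (lab x == i).
  have [//|nx] := pselect (exists x, (key x < n) && (lab x == i)).
  case: nj; exists i => x xn; apply: contra_notN nx => xi.
  by exists x; rewrite xn.
pose rep i := xchoose (used i).
have repn i : key (rep i) < n by have /andP[] := xchooseP (used i).
have repl i : lab (rep i) = i by have /andP[_ /eqP] := xchooseP (used i).
have [tau htau] := few_types n.
(* pigeonhole: there is one more label than there are types *)
have [i [i' [ii' tii]]] : exists i i', i != i' /\ tau (rep i) = tau (rep i').
  have [/injectiveP inj|/injectivePn[i [i' ? ?]]] :=
    boolP (injectiveb (fun i => tau (rep i))); last by exists i, i'.
  by have := leq_card _ inj; rewrite card_ord ltnn.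
have toRep x w : key x < n -> n <= key w -> sedge x w = sedge (rep (lab x)) w.
  by move=> xn wn; apply: hl; rewrite ?repl.
have repii w : n <= key w -> sedge (rep i) w = sedge (rep i') w.
  by move=> wn; apply: htau.
exists (fun x => if lab x == i then i' else lab x), i; split.
- exact: built_rename.
- by move=> x _; case: ifPn => // _; rewrite eq_sym.
- move=> x y w xn yn wn; rewrite (toRep x) ?(toRep y) //.
  case: (eqVneq (lab x) i) => [->|_]; case: (eqVneq (lab y) i) => [->|_] //.
  + by move=> <-; rewrite repii.
  + by move=> ->; rewrite repii.
  + by move=> ->.
Qed.

Lemma layout_step n : (forall w, n <= key w) \/ layout_inv n ->
  (forall w, n.+1 <= key w) \/ layout_inv n.+1.
Proof.
move=> hn.
have [[v kv]|nv] := pselect (exists v, key v = n); last first.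
  have lt w : (key w < n.+1) = (key w < n).
    by rewrite ltnS leq_eqVlt; case: eqP => // /(ex_intro _ w)/nv.
  have le w : (n < key w) = (n <= key w) by rewrite leqNgt lt -leqNgt.
  case: hn => [hn|[lab [j [hb hj hl]]]]; [left|right] => [w|].
    by rewrite le.
  exists lab, j; split=> [|x|x y w]; rewrite ?lt ?le; auto.
  by apply: built_ext hb => // w; rewrite lt.
right.
have [lab [j [hb hj hl]]] : exists (lab : G -> 'I_K) (j : 'I_K),
   [/\ (forall w, n <= key w) \/ built (fun w => key w < n) lab (@sedge G),
       forall x, key x < n -> lab x != j &
       forall x y w, key x < n -> key y < n -> n <= key w ->
         lab x = lab y -> sedge x w = sedge y w].
  case: hn => [hn|[lab [j [hb hj hl]]]].
    exists (fun=> ord0), ord0; split; first by left.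
      by move=> x; rewrite ltnNge hn.
    by move=> x y w; rewrite ltnNge hn.
  by exists lab, j; split=> //; right.
apply: layout_merge (layout_add_vertex kv hb hj hl) _ => x y w.
have lt u : key u < n.+1 -> (u == v) = false -> key u < n.
  rewrite ltnS leq_eqVlt -kv => /orP[/eqP/key_inj->|//].
  by rewrite eqxx.
move=> xn yn wn.
case: (eqVneq x v) => [->|/negbTE xv]; case: (eqVneq y v) => [->|/negbTE yv] //.
- by move=> jy; move: (hj _ (lt _ yn yv)); rewrite -jy eqxx.
- by move=> xj; move: (hj _ (lt _ xn xv)); rewrite xj eqxx.
- by apply: hl; rewrite ?lt // ltnW.
Qed.

Lemma layout_cw : cw_constructible K G.
Proof.
have h n : (forall w, n <= key w) \/ layout_inv n.
  by elim: n => [|n IH]; [left|exact: layout_step].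
pose N := (\max_w key w).+1.
have ltN w : key w < N by rewrite ltnS leq_bigmax.
have [hN|[lab [j [hb _ _]]]] := h N.
  by left; apply: eq_card0 => w; move: (hN w); rewrite leqNgt ltN.
by apply: (built_cw (lab := lab)); apply: built_ext hb => // w; rewrite ltN.
Qed.
End Layout.

(** * Column representations of unit interval graphs *)

(** Vertices of the same column are adjacent, and vertices of consecutive columns
are adjacent when the one in the later column is strictly higher.  Heights are
distinct, also between different columns. *)
Definition column_rep (G : sgraph) (col ht : G -> nat) : Prop :=
  injective ht /\ forall u v, u != v -> sedge u v =
    [|| col u == col v, (col v == (col u).+1) && (ht u < ht v)
      | (col u == (col v).+1) && (ht v < ht u)].

Lemma lt_lex_nat N a b r s : r < N -> a < b -> a * N + r < b * N + s.
Proof.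
move=> rN ab; apply: (@leq_trans (a.+1 * N)); first by rewrite mulSn; lia.
by apply: (@leq_trans (b * N)); [rewrite leq_mul2r ab orbT|exact: leq_addr].
Qed.

Section Representation.
Variable R : realType.
Import Order.TTheory GRing.Theory Num.Theory.
Local Open Scope ring_scope.

Lemma unit_intervals_meet (l a b : R) : 0 < l ->
  ((`[a, a + l] `&` `[b, b + l] !=set0)%classic <-> a <= b + l /\ b <= a + l).
Proof.
move=> l0; split.
  case=> y [] /=; rewrite !in_itv /= => /andP[h1 h2] /andP[h3 h4]; lra.
move=> [h1 h2]; have [ab|ab] := leP a b.
  by exists b; split=> /=; rewrite in_itv /=; apply/andP; split; lra.
by exists a; split=> /=; rewrite in_itv /=; apply/andP; split; lra.
Qed.

(** The condition of being at distance at most 1, in terms of integer and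
fractional parts. *)
Lemma dist_le1_truncn (x y : R) : 0 <= x -> 0 <= y ->
  let c (z : R) := Num.truncn z in
  let f (z : R) := z - (c z)%:R in
  (x <= y + 1) && (y <= x + 1) =
  [|| c x == c y, (c y == (c x).+1) && (f y <= f x)
    | (c x == (c y).+1) && (f x <= f y)].
Proof.
move=> x0 y0 c f.
have /andP[x1 x2] : (c x)%:R <= x < (c x).+1%:R by apply: Num.Theory.truncn_itv.
have /andP[y1 y2] : (c y)%:R <= y < (c y).+1%:R by apply: Num.Theory.truncn_itv.
rewrite /f; move: (c x) (c y) x1 x2 y1 y2 => {c f} m n x1 x2 y1 y2.
have far a b : (a.+1 < b)%N -> a%:R + 2 <= b%:R :> R.
  by rewrite -natrD ler_nat addn2.
rewrite -!natr1 in x2 y2.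
have [mn|nm|mn] := ltngtP m n; last by subst n; apply/andP; split; lra.
- have -> : (m == n.+1) = false by apply/negbTE/eqP; lia.
  have [enm|nm] := eqVneq n m.+1; rewrite /= ?orbF.
    subst n; rewrite -!natr1 in y1 y2 *.
    by apply/andP/idP => [[h1 h2]|h]; [lra|split; lra].
  have /far h : (m.+1 < n)%N by lia.
  by apply/negbTE/negP => /andP[]; lra.
- have -> : (n == m.+1) = false by apply/negbTE/eqP; lia.
  have [emn|nm'] := eqVneq m n.+1; rewrite /= ?orbF.
    subst m; rewrite -!natr1 in x1 x2 *.
    by apply/andP/idP => [[h1 h2]|h]; [lra|split; lra].
  have /far h : (n.+1 < m)%N by lia.
  by apply/negbTE/negP => /andP[]; lra.
Qed.

Lemma unit_interval_column_rep (G : sgraph) : unit_interval_graph R G ->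
  exists col ht : G -> nat, column_rep col ht.
Proof.
case=> l [a [l0 adj]].
(* [B] makes all positions nonnegative, so that columns are natural numbers *)
pose B : R := \sum_v `|a v|.
pose x v := (a v + B) / l.
have x0 v : 0 <= x v.
  apply: divr_ge0; last exact: ltW.
  rewrite /B (bigD1 v) //= addrA; apply: addr_ge0; last exact: sumr_ge0.
  by have := ler_norm (- a v); rewrite normrN; lra.
pose c v := Num.truncn (x v).
pose f v := x v - (c v)%:R.
have edge u v : u != v -> sedge u v = (x u <= x v + 1) && (x v <= x u + 1).
  move=> uv; rewrite /x.
  have e w w' : ((a w + B) / l <= (a w' + B) / l + 1) = (a w <= a w' + l).
    have -> : (a w' + B) / l + 1 = (a w' + B + l) / l.
      by rewrite [in RHS]mulrDl divff ?lt0r_neq0.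
    rewrite ler_pM2r ?invr_gt0 //.
    by apply/idP/idP; lra.
  rewrite !e; apply/idP/andP => [/(adj _ _ uv)|] /unit_intervals_meet; first exact.
  by move=> /(_ l0); move/(adj _ _ uv).
(* [rk] reverses the order of the fractional parts *)
pose rk v := #|[pred w : G | f v < f w]|.
have rkE u v : (f v <= f u) = (rk u <= rk v)%N.
  apply/idP/idP => [vu|].
    by apply/subset_leq_card/fintype.subsetP => w; rewrite !inE; exact: le_lt_trans.
  apply: contraTT; rewrite -ltNge -ltnNge => uv; apply/proper_card/properP.
  split; last by exists v; rewrite !inE ?ltxx.
  by apply/fintype.subsetP => w; rewrite !inE; apply: lt_trans.
pose C := (\max_v c v).+1.
have cC v : (c v < C)%N by rewrite ltnS leq_bigmax.
(* vertices of equal rank are ordered by column, since positions that differ by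
   exactly 1 are adjacent, and then arbitrarily *)
pose ht v := ((rk v * C + c v) * #|G| + enum_rank v)%N.
have htE u v : c v = (c u).+1 -> (ht u < ht v)%N = (f v <= f u).
  move=> cuv; rewrite rkE; have [uv|vu] := leqP (rk u) (rk v).
    apply: lt_lex_nat; first exact: ltn_ord.
    by rewrite -addnS -cuv leq_add2r leq_mul2r uv orbT.
  apply/negbTE; rewrite -leqNgt ltnW //; apply: lt_lex_nat; first exact: ltn_ord.
  exact: lt_lex_nat.
exists c, ht; split.
  move=> u v /(congr1 (modn^~ #|G|)); rewrite !modnMDl !modn_small ?ltn_ord //.
  by move=> h; apply: enum_rank_inj; apply: val_inj.
move=> u v uv; rewrite edge // dist_le1_truncn // -/(c _) -/(c _).
congr [|| _, _ | _].
  by case: eqP => //= h; rewrite htE.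
by case: eqP => //= h; rewrite htE.
Qed.
End Representation.

(** * Grids and phases *)

(** The vertices [z 0, ..., z (N - 1)] have increasing heights and run cyclically
through the [W] columns starting at [b]. *)
Definition grid (V : Type) (col ht : V -> nat) (b W N : nat) (z : nat -> V) :=
  (forall n, n < N -> col (z n) = b + n %% W) /\
  (forall n m, n < m -> m < N -> ht (z n) < ht (z m)).

(** The phases are consecutive ranges of heights, numbered from [0] to at most
[N], such that a vertex of phase [q] in column [b + q mod W] is the lowest of its
phase. *)
Definition phases (V : Type) (col ht : V -> nat) (b W N : nat) (p : V -> nat) :=
  [/\ forall v, p v <= N, forall u v, ht u <= ht v -> p u <= p v &
      forall u v, p u = p v -> col v = b + p v %% W -> ht v <= ht u].

(** The greedy construction: the chosen vertices are [z], and [p v] counts the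
chosen vertices that are no higher than [v]. *)
Lemma grid_or_phases (V : finType) (x0 : V) (col ht : V -> nat) (b W N : nat) :
  (exists z, grid col ht b W N z) \/ (exists p, phases col ht b W N p).
Proof.
(* [t] is one more than the height of the last chosen vertex, and 0 at the
   beginning; the last phase starts at that vertex *)
suff [|[p h]] : (exists z t p, [/\ grid col ht b W N z,
      forall n, n < N -> ht (z n) < t,
      forall v, p v <= N /\ (p v == N) = (t <= (ht v).+1),
      forall u v, ht u <= ht v -> p u <= p v &
      forall u v, p v < N -> p u = p v -> col v = b + p v %% W -> ht v <= ht u])
    \/ exists p, phases col ht b W N p.
- by case=> z [t [p []]]; left; exists z.
- by right; exists p.
elim: N => [|N [[z [t [p [[zc zh] zt pN pm pl]]]]|[p [pN pm pl]]]].
- by left; exists (fun=> x0), 0, (fun=> 0).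
- have [[v0 /andP[/eqP cv0 tv0]]|nv] :=
    pselect (exists v, (col v == b + N %% W) && (t <= ht v)); last first.
    (* no vertex can be chosen: only the last chosen one may lie in column
       [b + N mod W] of the last phase, and it is the lowest there *)
    right; exists p; split=> // [v|u v puv cv]; first by have [/leqW] := pN v.
    have [pv|pv] := ltnP (p v) N; first exact: pl.
    have {pv}pvN : p v = N by have [? _] := pN v; lia.
    have hv : ~ (t <= ht v).
      by move=> tv; apply: nv; exists v; rewrite cv pvN eqxx.
    by have [_] := pN u; rewrite puv pvN eqxx; lia.
  pose P v := (col v == b + N %% W) && (t <= ht v).
  have Pv0 : P v0 by rewrite /P cv0 eqxx.
  case: (@arg_minnP _ v0 P ht Pv0) => v /andP[/eqP cv tv] vmin.
  left; exists (fun n => if n == N then v else z n), (ht v).+1.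
  exists (fun u => if ht v <= ht u then N.+1 else p u).
  split.
  + split=> [n nN|n m nm mN]; first by case: eqP => [->//|?]; apply: zc; lia.
    have -> : (n == N) = false by apply/eqP; lia.
    have [emN|mN'] := eqVneq m N; last by apply: zh; lia.
    by apply: leq_trans tv; apply: zt; lia.
  + move=> n nN; case: eqP => [//|?].
    by rewrite ltnS ltnW //; apply: leq_trans tv; apply: zt; lia.
  + move=> u; have [uN _] := pN u; rewrite ltnS.
    by case: (leqP (ht v) (ht u)) => _; split; lia.
  + move=> u w uw; have [uN _] := pN u; have := pm _ _ uw.
    by case: (leqP (ht v) (ht u)); case: (leqP (ht v) (ht w)); lia.
  + move=> u w; case: (leqP (ht v) (ht w)) => [_|vw]; first by rewrite ltnn.
    move=> _; case: (leqP (ht v) (ht u)) => [_|vu].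
      by have [? _] := pN w; lia.
    have [wN tw] := pN w; have [uN tu] := pN u.
    have [pw|pw] := ltnP (p w) N; first exact: pl.
    have {pw}pwN : p w = N by lia.
    move=> puw; rewrite pwN => cw.
    have wt : ~ (t <= ht w).
      move=> htw; have : P w by rewrite /P cw eqxx.
      by move/vmin; lia.
    by move: tu; rewrite puw pwN eqxx; lia.
- right; exists p; split=> // v; exact: leqW.
Qed.

Lemma grid_embedding (H G : sgraph) (colH htH : H -> nat) (col ht : G -> nat)
    (b W N : nat) (z : nat -> G) :
  column_rep colH htH -> column_rep col ht ->
  (forall h, colH h < W) -> (forall h, htH h < N) ->
  grid col ht b W (N * W) z ->
  exists f : H -> G, injective f /\ forall x y, sedge (f x) (f y) = sedge x y.
Proof.
move=> [hinj hE] [_ gE] cW hN [zc zh].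
pose i h := htH h * W + colH h.
have iN h : i h < N * W by rewrite -[N * W]addn0; apply: lt_lex_nat.
have fc h : col (z (i h)) = b + colH h.
  by rewrite zc ?iN // modnMDl modn_small.
have ilt x y : htH x < htH y -> ht (z (i x)) < ht (z (i y)).
  by move=> xy; apply: zh => //; apply: lt_lex_nat.
have zlt x y : (ht (z (i x)) < ht (z (i y))) =
    (htH x < htH y) || (htH x == htH y) && (colH x < colH y).
  have [xy|yx|exy] := ltngtP (htH x) (htH y); first by rewrite ilt.
    by apply/negbTE; rewrite -leqNgt ltnW // ilt.
  by have -> := hinj _ _ exy; rewrite !ltnn.
have finj : injective (fun h => z (i h)).
  move=> x y /= e; apply: hinj.
  have [/ilt|/ilt|//] := ltngtP (htH x) (htH y); by rewrite e ltnn.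
exists (fun h => z (i h)); split=> // x y.
have [->|xy] := eqVneq x y; first by rewrite !sedge_irr.
have xy' : z (i x) != z (i y) by rewrite (inj_eq finj).
have hxy : (htH x == htH y) = false by rewrite (inj_eq hinj); apply/negbTE.
rewrite gE // hE // !fc eqn_add2l -!addnS !eqn_add2l !zlt.
by rewrite [htH y == _]eq_sym hxy !orbF.
Qed.

(** * Clique-width from phases *)

(** Phases are given for each of the windows of [W] columns starting at a multiple
of [W]. *)
Section PhasesWidth.
Variables (G : sgraph) (col ht : G -> nat) (W P : nat) (p : nat -> G -> nat).
Hypothesis W0 : 0 < W.
Hypothesis rep : column_rep col ht.
Hypothesis ph : forall i, phases col ht (i * W) W P (p i).

(** The left side of the [i]-th cut.  It contains all the columns before [i * W]
and is contained in the columns before [(i + 1) * W]. *)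
Definition left_part (i : nat) (v : G) : bool := col v < i * W + p i v %% W.

(** The index of the first cut that has [v] on its left; see [block_le]. *)
Definition block (v : G) : nat := col v %/ W + ~~ left_part (col v %/ W) v.

Lemma left_part_far i v : left_part i v -> col v < i.+1 * W.
Proof.
by move=> h; apply: leq_trans h _; rewrite mulSnr leq_add2l ltnW // ltn_pmod.
Qed.

Lemma left_part_near i v : col v < i * W -> left_part i v.
Proof. by move=> h; apply: leq_trans h (leq_addr _ _). Qed.

Lemma block_le i v : (block v <= i) = left_part i v.
Proof.
rewrite /block; have [ic|ci|->] := ltngtP i (col v %/ W).
- apply/idP/idP => [|/left_part_far h]; first by lia.
  suff : i.+1 * W <= col v by rewrite leqNgt h.
  by apply: leq_trans (leq_trunc_div (col v) W); rewrite leq_mul2r ic orbT.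
- rewrite [left_part i v]left_part_near; first by case: left_part; lia.
  by apply: (@leq_trans ((col v %/ W).+1 * W)); rewrite ?ltn_ceil ?leq_mul2r ?ci ?orbT.
- by case: left_part; rewrite ?addn0 ?leqnn // addn1 ltnn.
Qed.

(** Across a cut, comparing heights in consecutive columns amounts to comparing
phases: a vertex on the right which is in the next column and in the same phase
is the lowest of its phase. *)
Lemma cut_right i u v : left_part i u -> ~~ left_part i v ->
  col v = (col u).+1 -> (ht u < ht v) = (p i u < p i v).
Proof.
have [_ pm pl] := ph i; rewrite /left_part => lu lv cuv.
have [uv|vu] := ltnP (p i u) (p i v).
  by rewrite ltnNge; apply/negP => /pm; rewrite leqNgt uv.
apply/negbTE; rewrite -leqNgt leqNgt; apply/negP => huv.
have e : p i u = p i v by apply/eqP; rewrite eqn_leq vu (pm _ _ (ltnW huv)).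
move: (pl u v e); rewrite e in lu.
move: (i * W + p i v %% W) lu lv => q lu lv low.
by have := low ltac:(lia); lia.
Qed.

Lemma cut_left i u v : left_part i u -> ~~ left_part i v ->
  col u = (col v).+1 -> (ht v < ht u) = (p i v < p i u).
Proof.
have [_ pm _] := ph i; rewrite /left_part => lu lv cuv.
have [uv|vu] := ltnP (p i v) (p i u).
  by rewrite ltnNge; apply/negP => /pm; rewrite leqNgt uv.
apply/negbTE; rewrite -leqNgt leqNgt; apply/negP => huv.
have e : p i u = p i v by apply/eqP; rewrite eqn_leq vu (pm _ _ (ltnW huv)).
by rewrite e in lu; move: (i * W + _) lu lv => q lu lv; lia.
Qed.

(** The column of [v] relative to the [i]-th window.  The truncated subtraction
only identifies columns too far to the left to have neighbours beyond the
[i]-th cut. *)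
Definition offset (i : nat) (v : G) : nat := col v + W + 2 - i * W.

Lemma cut_type i u u' w : left_part i u -> left_part i u' -> ~~ left_part i w ->
  offset i u = offset i u' -> p i u = p i u' -> sedge u w = sedge u' w.
Proof.
move=> lu lu' lw off pe; have [_ gE] := rep.
have neq x : left_part i x -> x != w by apply: contraTneq => ->.
rewrite !gE ?neq //.
have cw : i * W <= col w by rewrite leqNgt; apply: contra lw; exact: left_part_near.
have [cu|cu] := leqP (col u + W + 2) (i * W).
  have cu' : col u' + W + 2 <= i * W by move: off; rewrite /offset; lia.
  by do 6![case: eqP => ? /=; try lia].
have cuu' : col u = col u' by move: off; rewrite /offset; lia.
congr [|| _, _ | _]; rewrite ?cuu' //.
- by case: eqP => //= h; rewrite !(@cut_right i) ?pe // cuu'.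
- by case: eqP => //= h; rewrite !(@cut_left i) ?pe // cuu'.
Qed.

Lemma offset_lt i u : left_part i u -> offset i u < (2 * W + 1).+1.
Proof. by move=> /left_part_far; rewrite /offset mulSn; lia. Qed.

(** Inside a block, a vertex sees the higher vertices according to its column. *)
Lemma block_type i u u' w : block u = i -> block u' = i -> block w = i ->
  ht u < ht w -> ht u' < ht w -> offset i u = offset i u' ->
  sedge u w = sedge u' w.
Proof.
move=> bu bu' bw uw u'w off; have [_ gE] := rep.
have neq x : ht x < ht w -> x != w by apply: contraTneq => ->; rewrite ltnn.
have low x : block x = i -> i * W <= col x + W.
  case: i {bu bu' bw off} => [|i] bx; first by rewrite mul0n.
  rewrite mulSn addnC leq_add2r leqNgt; apply/negP => /left_part_near.
  by rewrite -block_le bx ltnn.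
have cuu' : col u = col u' by move: off (low _ bu) (low _ bu'); rewrite /offset; lia.
rewrite !gE ?neq // cuu' uw u'w.
by rewrite [ht w < ht u]ltnNge [ht w < ht u']ltnNge (ltnW uw) (ltnW u'w).
Qed.

Lemma phases_cw :
  cw_constructible #|{: bool * 'I_(2 * W + 1).+1 * 'I_P.+1}|.+1 G.
Proof.
have [hinj _] := rep.
pose M := (\max_v ht v).+1.
have hM v : ht v < M by rewrite ltnS leq_bigmax.
pose key v := block v * M + ht v.
have ltkey n v : (key v < n) =
    (block v < n %/ M) || (block v == n %/ M) && (ht v < n %% M).
  have nE := divn_eq n M; rewrite /key {1}nE.
  have [bl|bg|->] /= := ltngtP (block v) (n %/ M); last by rewrite ltn_add2l.
    exact: lt_lex_nat.
  by apply/negbTE; rewrite -leqNgt ltnW //; apply: lt_lex_nat; rewrite ?ltn_pmod.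
apply: (@layout_cw _ _ key) => [u v /(congr1 (modn^~ M))|n].
  by rewrite !modnMDl !modn_small //; exact: hinj.
set i := n %/ M.
(* the vertices before block [i] are all on the left of cut [i - 1]; those of
   block [i] are described by their position with respect to cut [i] *)
pose j u := if block u < i then i.-1 else i.
pose tau u : bool * 'I_(2 * W + 1).+1 * 'I_P.+1 :=
  (block u < i, inord (offset (j u) u), inord (p (j u) u)).
exists tau => u u' w; rewrite [n <= _]leqNgt !ltkey -/i => ku ku' kw [].
have inl x : (block x < i) || (block x == i) && (ht x < n %% M) -> left_part (j x) x.
  rewrite -block_le /j; case: ltnP => /= [bx _|_ /andP[/eqP-> //]].
  by rewrite -ltnS prednK //; lia.
have lu := inl _ ku; have lu' := inl _ ku'.
have pP i' x : p i' x < P.+1 by rewrite ltnS; case: (ph i').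
move=> bb /(congr1 val) /=; rewrite !inordK ?offset_lt // => off.
move=> /(congr1 val) /=; rewrite !inordK // => pe.
have jj : j u = j u' by rewrite /j bb.
move: kw; rewrite negb_or -leqNgt => /andP[bw hw].
rewrite -jj in off pe lu'.
have [lw|lw] := boolP (left_part (j u) w); last exact: (cut_type lu lu').
move: lw ku ku'; rewrite -block_le -bb /j; case: ltnP => [bu|bu] lw /=; first by lia.
have bwi : block w = i by lia.
move=> /andP[/eqP bui hu] /andP[/eqP bui' hu'].
move: hw; rewrite bwi eqxx /= -leqNgt => hw.
apply: (block_type bui bui' bwi); [lia|lia|].
by move: off; rewrite /j ltnNge bu.
Qed.
End PhasesWidth.

Lemma clique_width_le K G : cw_constructible K G -> clique_width G <= K.
Proof.
by move=> h; rewrite /clique_width; case: ex_minnP => m _; apply; apply/asboolP.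
Qed.

Lemma hereditary_embedding (X : sgraph -> Prop) (H G : sgraph) (f : H -> G) :
  hereditary X -> X G -> injective f ->
  (forall x y, sedge (f x) (f y) = sedge x y) -> X H.
Proof.
move=> [iso ind] XG finj fE.
apply: iso (ind G [set f x | x in H]%SET XG).
have g1 (y : induced [set f x | x in H]%SET) : exists x, f x == val y.
  by have /imsetP[x _ e] := valP y; exists x; rewrite e.
exists (fun y => xchoose (g1 y)).
  have gK y : f (xchoose (g1 y)) = val y by apply/eqP; exact: (xchooseP (g1 y)).
  have fin x : f x \in [set f x | x in H]%SET by apply: imset_f.
  exists (fun x => exist _ (f x) (fin x)) => [y|x]; first by apply: val_inj; rewrite /= gK.
  by apply: finj; rewrite gK.
move=> x y; rewrite -fE.
by rewrite (eqP (xchooseP (g1 x))) (eqP (xchooseP (g1 y))).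
Qed.

Theorem theorem7 (R : realType) (X : sgraph -> Prop)
  (hX : hereditary X)
  (hsub : forall G : sgraph, X G -> unit_interval_graph R G)
  (hproper : exists G : sgraph, unit_interval_graph R G /\ ~ X G) :
  exists c : nat, forall G : sgraph, X G -> (clique_width G <= c)%N.
Proof.
have [H [/unit_interval_column_rep[colH [htH repH]] nXH]] := hproper.
pose W := (\max_h colH h).+1.
pose N := (\max_h htH h).+1.
have cW h : colH h < W by rewrite ltnS leq_bigmax.
have hN h : htH h < N by rewrite ltnS leq_bigmax.
exists #|{: bool * 'I_(2 * W + 1).+1 * 'I_(N * W).+1}|.+1 => G XG.
apply: clique_width_le.
have [G0|/card_gt0P[x0 _]] := posnP #|G|; first by left.
have [col [ht rep]] := unit_interval_column_rep (hsub G XG).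
have /choice[p hp] : forall i, exists p, phases col ht (i * W) W (N * W) p.
  move=> i; have [[z hz]|//] := grid_or_phases x0 col ht (i * W) W (N * W).
  have [f [finj fE]] := grid_embedding repH rep cW hN hz.
  by case: nXH; apply: hereditary_embedding hX XG finj fE.
exact: phases_cw (ltn0Sn _) rep hp.
Qed.
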